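(* Let $n\ge 1$, let $M_n$ be the set of permutations $\pi\in S_n$ from which there is a sequence of exactly $2^{n-1}-1$ successive placements ending at the identity (that is, permutations of height $2^{n-1}-1$), and let $B_m$ denote the $m$th Bell number. Then $|M_n|\ge B_{n-1}$.
   Context: A permutation $\pi\in S_n$ is written as the sequence $\pi(1),\dots,\pi(n)$, where $\pi(i)$ is the number in the $i$th position and $\pi^{-1}(i)$ is the position of the number $i$. A number $i$ is at home if $\pi(i)=i$. If $i$ is not at home, it may be placed: $i$ is removed from its current position $\pi^{-1}(i)$ and reinserted at position $i$, the numbers in the intervening positions each shifting by one position toward the vacated position, and all other numbers staying where they are. The height $h(\pi)$ is the maximum length of a sequence of placements leading from $\pi$ to the identity; the largest possible height in $S_n$ is $2^{n-1}-1$, and $M_n=\{\pi\in S_n: h(\pi)=2^{n-1}-1\}$. The Bell number $B_m$ is the number of set partitions of $\{1,\dots,m\}$ (with $B_0=1$). *)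

(* Defs.v *)
From mathcomp Require Import all_boot all_fingroup.

Set Implicit Arguments.
Unset Strict Implicit.
Unset Printing Implicit Defensive.

(* Positions and numbers both range over 'I_n = {0, ..., n-1}, so that the
   position or number written k in {1, ..., n} is k-1 here.  [codom pi] is the
   one-line notation [:: pi 0; ...; pi (n-1)]. *)

Definition at_home n (pi : 'S_n) (i : 'I_n) : bool := pi i == i.

Definition place_seq n (i : 'I_n) (s : seq 'I_n) : seq 'I_n :=
  let s' := rem i s in take i s' ++ i :: drop i s'.

Definition placement n : rel 'S_n :=
  fun pi sigma =>
    [exists i : 'I_n, ~~ at_home pi i && (codom sigma == place_seq i (codom pi))].

Definition sorts_in n (k : nat) (pi : 'S_n) : bool :=
  [exists p : k.-tuple 'S_n, path (@placement n) pi p && (last pi p == 1%g)].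

Definition M n : {set 'S_n} := [set pi | sorts_in (2 ^ (n - 1) - 1) pi].

Definition bell (m : nat) : nat :=
  #|[set P : {set {set 'I_m}} | partition P [set: 'I_m]]|.

(* Main.v *)
Require Import Defs.
From mathcomp Require Import all_boot all_fingroup.
From mathcomp Require Import zify.

Set Implicit Arguments.
Unset Strict Implicit.
Unset Printing Implicit Defensive.

(** Why the bound holds.  Call position and number [i] the home of [i].  Number
    the positions [0, ..., m+1], so that [n = m + 2], and consider the words
    [A ++ iota (size A) j ++ B]: a left region, then [j] numbers at home, then a
    right region.  The numbers of [A] and [B] are only obstacles.

    Towers of Hanoi.  If the [j] middle numbers stand one place too far left, so
    that the obstacle [x] which ought to precede them follows them instead, then
    [2^j - 1] placements bring them home and carry [x] to their left
    ([sorts_block_left]): bring home all but the largest, which pushes the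
    largest number [r] to the left of the block; place [r], which pushes all the
    others off home again; then bring those home a second time.  The mirror image
    is [sorts_block_right].

    Peeling.  Read the sorting backwards.  From [A ++ iota (size A) j.+1 ++ B] one
    can undo [2^j] placements and take one middle number out of the block:
    either the largest one, which goes to an arbitrary one of [size A] places in
    the left region while the last obstacle of [A] moves to the front of [B]
    ([to_left]); or the smallest one, which becomes the first element of the
    right region in exchange for the first obstacle of [B], which joins [A]
    ([to_right]).  Placing the peeled number and applying Towers of Hanoi leads
    back ([sorts_child]).  Peeling all [m] numbers off the word
    [m+1, 1, 2, ..., m, 0] thus costs [2^(m-1) + ... + 1 = 2^m - 1] placements;
    and [m+1, 1, ..., m, 0] itself is sorted by [2^m] placements, first [m+1] and
    then Towers of Hanoi ([sorts_root]).  The total is [2^(n-1) - 1].  For [n = 1]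
    the identity is sorted by no placement at all.

    Counting.  With [b = size A] there are [b] peelings that keep [b] and one
    that increases it, exactly as the next element of a set can join one of [b]
    blocks of a partition or open a new block.  As [b = 1] at the start, there
    are as many ways to peel as partitions of a set of [m + 1 = n - 1] elements
    ([rgf_count], [leq_bell]).  Different peelings end in different words: the
    last peeling was to the right if and only if the first number of [B] is
    [size A - 1] ([childrenK]), and the final word [A ++ B] tells where [A] ends
    because numbers peeled to the left stay strictly left of their home, and
    those peeled to the right strictly right of it ([word_inj]). *)

(** * Set partitions and restricted growth *)

(** The number of ways to let [k] further elements join a set partition with [b]
    blocks, one after the other. *)
Fixpoint rgf_count (k b : nat) : nat :=
  if k is k'.+1 then b * rgf_count k' b + rgf_count k' b.+1 else 1.

Lemma leq_rgf_count k b c : b <= c -> rgf_count k b <= rgf_count k c.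
Proof.
elim: k b c => // k IHk b c le_bc /=.
by rewrite leq_add ?leq_mul ?IHk.
Qed.

Section Partitions.

Variable T : finType.
Implicit Types (x : T) (P : {set {set T}}) (D : {set T}).

Definition add_point x P : seq {set {set T}} :=
  ([set x] |: P) :: [seq (x |: B) |: (P :\ B) | B <- enum P].

Fixpoint partitions (s : seq T) : seq {set {set T}} :=
  if s is x :: s' then flatten [seq add_point x P | P <- partitions s']
  else [:: set0].

(** Removing [x] from the block [B] that contains it gives a partition of [D];
    the block disappears altogether when [B = [set x]]. *)
Lemma partition_add_point x D P :
    x \notin D -> partition P (x |: D) ->
  exists2 P', partition P' D & P \in add_point x P'.
Proof.
move=> xD pP; have /and3P[/eqP covP tI P0] := pP.
have xP : x \in cover P by rewrite covP setU11.
set B := pblock P x.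
have BP : B \in P by rewrite pblock_mem.
have xB : x \in B by rewrite mem_pblock.
have pPB : partition (P :\ B) ((x |: D) :\: B) by exact: partitionD1.
have sBD : B \subset x |: D by rewrite -covP /cover; exact: (bigcup_max B).
have [Bx|Bx] := eqVneq B [set x].
  exists (P :\ B); first by move: pPB; rewrite {2}Bx setU1K.
  by rewrite inE -Bx setD1K ?eqxx.
pose C := B :\ x.
have DC : D = C :|: ((x |: D) :\: B).
  apply/setP=> y; rewrite /C !inE; have [->|yx] /= := eqVneq y x.
    by rewrite xB (negbTE xD).
  case yB: (y \in B) => //=.
  by have := subsetP sBD y yB; rewrite !inE (negbTE yx).
have C0 : C != set0.
  apply: contraNneq Bx => C0.
  by rewrite -(setD1K xB) -/C C0 setU0.
have CP : C \notin P :\ B.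
  apply/negP => CP; case/set0Pn: C0 => y yC.
  have yc : y \in cover (P :\ B) by apply/bigcupP; exists C.
  move: yc; rewrite (cover_partition pPB) inE.
  by move: yC; rewrite /C inE => /andP[_ ->].
exists (C |: (P :\ B)).
  rewrite [X in partition _ X]DC; apply: partitionU1 => //.
  rewrite -setI_eq0; apply/eqP/setP=> y; rewrite /C !inE.
  by case: (y \in B); rewrite ?andbF.
rewrite inE; apply/orP; right; apply/mapP; exists C; first by rewrite mem_enum setU11.
by rewrite /C setD1K // -/C setU1K // setD1K.
Qed.

Lemma mem_partitions s P :
  uniq s -> partition P [set:: s] -> P \in partitions s.
Proof.
elim: s P => [|x s IHs] P /=.
  by rewrite set_nil partition_set0 inE.
case/andP=> xs us; rewrite set_cons => /partition_add_point[].
  by rewrite inE.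
move=> P' /(IHs _ us) P'in Pin.
by apply/flattenP; exists (add_point x P') => //; apply: map_f.
Qed.

(** Weighting by the number of continuations turns the recursion on [rgf_count]
    into an induction step.  It is an inequality because, for an arbitrary set
    [P] of sets, an enlarged block may coincide with another member of [P]. *)
Lemma sum_partitions s k :
  \sum_(P <- partitions s) rgf_count k #|P| <= rgf_count (size s + k) 0.
Proof.
elim: s k => [|x s IHs] k; first by rewrite big_seq1 cards0.
rewrite [size _]/= addSnnS [partitions _]/= big_flatten big_map.
apply: leq_trans (IHs k.+1); apply: leq_sum => P _ /=.
rewrite big_cons big_map addnC leq_add //.
  rewrite big_enum /= -sum_nat_const; apply: leq_sum => B PB; apply: leq_rgf_count.
  by rewrite cardsU1 (cardsD1 B P) PB leq_add2r leq_b1.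
by apply: leq_rgf_count; rewrite cardsU1 -[#|P|.+1]add1n leq_add2r leq_b1.
Qed.

End Partitions.

Lemma leq_bell m : bell m <= rgf_count m 0.
Proof.
rewrite /bell cardE.
apply: (@leq_trans (size (partitions (enum 'I_m)))).
  apply: uniq_leq_size; first exact: enum_uniq.
  move=> P; rewrite mem_enum inE => pP; apply: mem_partitions.
    exact: enum_uniq.
  by congr (partition _ _): pP; apply/setP=> i; rewrite !inE mem_enum.
have := sum_partitions (enum 'I_m) 0.
by rewrite addn0 /= sum1_size size_enum_ord.
Qed.

(** * Placements on words of natural numbers *)

Definition place (i : nat) (s : seq nat) : seq nat :=
  take i (rem i s) ++ i :: drop i (rem i s).

Definition place_rel : rel (seq nat) := fun s t =>
  has (fun i => (nth 0 s i != i) && (t == place i s)) (iota 0 (size s)).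

Definition sorts (k : nat) (s t : seq nat) : Prop :=
  exists2 p, size p = k & path place_rel s p /\ last s p = t.

Lemma sorts0 s : sorts 0 s s.
Proof. by exists [::]. Qed.

Lemma sorts_trans k1 k2 s t u : sorts k1 s t -> sorts k2 t u -> sorts (k1 + k2) s u.
Proof.
case=> p <- [p1 p2] [q <- [q1 q2]]; exists (p ++ q); first by rewrite size_cat.
by rewrite cat_path last_cat p1 p2 q1 q2.
Qed.

Lemma perm_place i s : i \in s -> perm_eq (place i s) s.
Proof.
move=> si; rewrite /place -cat1s perm_catCA /= cat_take_drop perm_sym.
exact: perm_to_rem.
Qed.

Lemma rem_mid (i : nat) X Y : i \notin X -> rem i (X ++ i :: Y) = X ++ Y.
Proof.
elim: X => [|x X IHX] /=; rewrite ?eqxx // inE negb_or eq_sym.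
by case/andP=> /negbTE-> /IHX->.
Qed.

(** The number [i] may stand on either side of its home in the word; the
    hypothesis [X ++ Y = X' ++ Y'] covers both directions of the shift. *)
Lemma sorts_place i X Y X' Y' :
    i = size X' -> X ++ Y = X' ++ Y' -> uniq (X ++ i :: Y) -> size X != i ->
  sorts 1 (X ++ i :: Y) (X' ++ i :: Y').
Proof.
move=> di eXY uXY Xi; exists [:: X' ++ i :: Y'] => //; split=> //=; rewrite andbT.
have iX : i \notin X by move: uXY; rewrite cat_uniq /= negb_or => /and3P[_ /andP[]].
have ilt : i < size (X ++ i :: Y).
  by move/(congr1 size): eXY; rewrite !size_cat /=; lia.
apply/hasP; exists i; first by rewrite mem_iota.
apply/andP; split.
  apply: contraNneq Xi => e.
  by rewrite -[X in _ == X](index_uniq 0 ilt uXY) e index_cat (negbTE iX) /= eqxx addn0.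
by rewrite /place rem_mid // eXY take_size_cat // drop_size_cat.
Qed.

(** * Towers of Hanoi *)

Ltac perm_by_count :=
  apply/seq.permP => ?; rewrite -?cats1; do ! rewrite ?count_cat /=; lia.

Lemma iotaS_rcons l j : iota l j.+1 = iota l j ++ [:: l + j].
Proof. by rewrite -addn1 iotaD. Qed.

(** Towers of Hanoi from the left: for [j.+1] the largest number [r] of the block
    plays the part of the obstacle while the [j] smaller ones go home, then [r]
    is placed, and the [j] smaller ones go home again and carry [x] along. *)
Lemma sorts_block_left j A x B :
  uniq (A ++ iota (size A).+1 j ++ x :: B) ->
  sorts (2 ^ j - 1) (A ++ iota (size A).+1 j ++ x :: B)
                    (A ++ x :: iota (size A).+1 j ++ B).
Proof.
elim: j x B => [|j IHj] x B; first by move=> _; exact: sorts0.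
set r := (size A).+1 + j.
rewrite iotaS_rcons -/r -!catA /= => uS.
have -> : 2 ^ j.+1 - 1 = (2 ^ j - 1) + (1 + (2 ^ j - 1)).
  by rewrite expnS; have := expn_gt0 2 j; lia.
apply: sorts_trans (IHj r (x :: B) uS) _.
have pS : perm_eq (A ++ iota (size A).+1 j ++ r :: x :: B)
   (A ++ iota (size A).+1 j ++ x :: r :: B) by perm_by_count.
have pS' : perm_eq (A ++ iota (size A).+1 j ++ r :: x :: B)
   (A ++ r :: iota (size A).+1 j ++ x :: B) by perm_by_count.
apply: sorts_trans (IHj x (r :: B) _); last by rewrite -(perm_uniq pS).
rewrite -[x :: r :: B]/([:: x] ++ r :: B) !catA; apply: sorts_place.
- by rewrite !size_cat size_iota /= /r; lia.
- by rewrite -!catA.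
- by rewrite -(perm_uniq pS').
- by rewrite /r; lia.
Qed.

(** The mirror image: now the smallest number [l] of the block is the
    obstacle of the first half. *)
Lemma sorts_block_right j A x B :
  uniq (A ++ x :: iota (size A) j ++ B) ->
  sorts (2 ^ j - 1) (A ++ x :: iota (size A) j ++ B)
                    (A ++ iota (size A) j ++ x :: B).
Proof.
elim: j x A => [|j IHj] x A; first by move=> _; exact: sorts0.
set l := size A => /= uS.
have -> : 2 ^ j.+1 - 1 = (2 ^ j - 1) + (1 + (2 ^ j - 1)).
  by rewrite expnS; have := expn_gt0 2 j; lia.
have := IHj l (rcons A x); rewrite size_rcons -/l !cat_rcons => /(_ uS).
move/sorts_trans; apply.
have pS : perm_eq (A ++ x :: l :: iota l.+1 j ++ B)
   (A ++ l :: x :: iota l.+1 j ++ B) by perm_by_count.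
have pS' : perm_eq (A ++ x :: l :: iota l.+1 j ++ B)
   (A ++ x :: iota l.+1 j ++ l :: B) by perm_by_count.
have := IHj x (rcons A l); rewrite size_rcons -/l !cat_rcons -(perm_uniq pS).
move=> /(_ uS); apply: sorts_trans.
rewrite -cat_rcons catA; apply: sorts_place => //.
- by rewrite -catA cat_rcons.
- by rewrite -catA cat_rcons -(perm_uniq pS').
- by rewrite size_cat size_rcons size_iota /l; lia.
Qed.

(** * Peeling the block of numbers at home *)

(** A state is the pair of the left and the right region. *)
Definition state : Type := (seq nat * seq nat)%type.
Implicit Types (st : state) (S : seq state).

Definition word j st := st.1 ++ iota (size st.1) j ++ st.2.

Definition insert p (x : nat) s := take p s ++ x :: drop p s.

(** [j] is the length of the block that remains, hence [size st.1 + j] is the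
    largest number of the block before the peeling. *)
Definition to_left j st p : state :=
  (insert p (size st.1 + j) (take (size st.1).-1 st.1), last 0 st.1 :: st.2).

Definition to_right st : state :=
  (rcons st.1 (head 0 st.2), size st.1 :: behead st.2).

Definition children j st : seq state :=
  to_right st :: [seq to_left j st p | p <- iota 0 (size st.1)].

Fixpoint descendants j S : seq state :=
  if j is j'.+1 then descendants j' (flatten [seq children j' st | st <- S]) else S.

(** The last two conditions say that a number already peeled to the right
    (smaller than [size st.1]) which has returned to the left region lies right of
    its home, and that one peeled to the left (at least [size st.1 + j]) which
    has moved to the right region lies left of it.  For the numbers that have
    remained on the side to which they were peeled this is automatic. *)
Definition valid n j st : Prop :=
  [/\ 0 < size st.1 /\ 0 < size st.2, perm_eq (word j st) (iota 0 n),
      forall i, i < size st.1 -> nth 0 st.1 i < size st.1 -> nth 0 st.1 i < i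
    & forall i, i < size st.2 -> size st.1 + j <= nth 0 st.2 i ->
        size st.1 + j + i < nth 0 st.2 i].

Lemma size_insert p x s : size (insert p x s) = (size s).+1.
Proof. by rewrite size_cat /= addnS -size_cat cat_take_drop. Qed.

(** The recursion of [rgf_count]: if the left region has size [b], then [b]
    children have a left region of size [b] and one has size [b.+1]. *)
Lemma size_descendants j S :
  (forall st, st \in S -> 0 < size st.1) ->
  size (descendants j S) = \sum_(st <- S) rgf_count j (size st.1).
Proof.
elim: j S => [|j IHj] S S0 /=; first by rewrite sum1_size.
have sz p st : st \in S -> size (to_left j st p).1 = size st.1.
  by move=> /S0 s0; rewrite /= size_insert size_takel ?leq_pred ?prednK.
rewrite IHj => [|st /flattenP[_ /mapP[st' st'S ->]]]; last first.
  rewrite inE => /orP[/eqP->|/mapP[p _ ->]]; first by rewrite size_rcons.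
  by rewrite sz ?S0.
rewrite big_flatten big_map; apply: eq_big_seq => st stS.
rewrite big_cons big_map size_rcons addnC; congr (_ + _).
under eq_bigr do rewrite sz //.
by rewrite big_const_seq count_predT size_iota iter_addn_0 mulnC.
Qed.

(** Writing the left region as [rcons A x] exposes the obstacle [x] that a peeling
    to the left carries across the block. *)
Lemma to_left_rcons j A x B p :
  to_left j (rcons A x, B) p = (insert p ((size A).+1 + j) A, x :: B).
Proof. by rewrite /to_left /= size_rcons last_rcons -cats1 take_size_cat. Qed.

Lemma word_rcons j A x B :
  word j.+1 (rcons A x, B) =
  A ++ x :: iota (size A).+1 j ++ ((size A).+1 + j) :: B.
Proof. by rewrite /word size_rcons iotaS_rcons cat_rcons -!catA. Qed.

Lemma perm_insert p x s : perm_eq (insert p x s) (x :: s).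
Proof. by rewrite /insert -cat1s perm_catCA /= cat_take_drop. Qed.

Lemma perm_to_left j A x B p :
  perm_eq (word j (to_left j (rcons A x, B) p)) (word j.+1 (rcons A x, B)).
Proof.
rewrite word_rcons to_left_rcons /word /= size_insert.
set r := _ + j.
apply: (@perm_trans _ ((r :: A) ++ iota (size A).+1 j ++ x :: B)).
  by rewrite perm_cat2r perm_insert.
by perm_by_count.
Qed.

Lemma perm_to_right j A y B :
  perm_eq (word j (to_right (A, y :: B))) (word j.+1 (A, y :: B)).
Proof. by rewrite /word /to_right /= size_rcons; perm_by_count. Qed.

Lemma uniq_middle j st y :
  uniq (word j st) -> y \in iota (size st.1) j -> (y \notin st.1) /\ (y \notin st.2).
Proof.
rewrite /word uniq_catCA cat_uniq => /and3P[_ /hasPn h _] yi.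
by apply/andP; rewrite -negb_or -mem_cat; apply: contraL yi => /h.
Qed.

(** Obstacles that change sides stay off home because the position that they
    reach is the home of the number just peeled; all others keep their position
    in the word, or move one place to the right inside the left region. *)
Lemma valid_children n j st st' :
  valid n j.+1 st -> st' \in children j st -> valid n j st'.
Proof.
case: st => A B [[/= A0 B0] pW invA invB] st'in.
have uW : uniq (word j.+1 (A, B)) by rewrite (perm_uniq pW) iota_uniq.
move: st'in; rewrite inE => /orP[/eqP->|/mapP[p]].
- case: B B0 pW invB uW => // y B _ pW invB uW.
  have lmid : size A \in iota (size A) j.+1 by rewrite mem_iota; lia.
  have [/= lA lB] := uniq_middle uW lmid; split.
  + by rewrite size_rcons.
  + by rewrite (perm_trans (perm_to_right _ _ _ _)).
  + move=> i; rewrite /= size_rcons ltnS leq_eqVlt nth_rcons => /orP[/eqP->|iA].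
      have : y != size A by apply: contraNneq lB => ->; rewrite inE eqxx.
      by rewrite ltnn eqxx => /eqP; lia.
    rewrite iA => h; apply: invA => //.
    have : nth 0 A i != size A by apply: contraNneq lA => <-; exact: mem_nth.
    by move=> /eqP; lia.
  + rewrite /= size_rcons => -[|i] /=; first lia.
    by move=> iB h; have := invB i.+1 iB; rewrite /=; lia.
- case/lastP: A A0 pW invA invB uW => // A x _ pW invA invB uW.
  rewrite mem_iota /= size_rcons => pA ->.
  set r := (size A).+1 + j.
  have rmid : r \in iota (size (rcons A x)) j.+1.
    by rewrite mem_iota size_rcons /r; lia.
  have [/= rA rB] := uniq_middle uW rmid.
  rewrite size_rcons in invA invB.
  split; rewrite ?(perm_trans (perm_to_left _ _ _ _ _)) // to_left_rcons /=
    size_insert //.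
  + move=> i iA; rewrite -/r /insert nth_cat size_takel //.
    case: (ltnP i p) => ip h.
      have iA' : i < size A by lia.
      move: h; rewrite nth_take // => h.
      by have := invA i iA; rewrite nth_rcons iA'; apply.
    move: ip; rewrite leq_eqVlt => /orP[/eqP e|ip].
      by move: h; rewrite e subnn /= /r; lia.
    move: h; rewrite -(subnSK ip) /= nth_drop.
    have -> : p + (i - p.+1) = i.-1 by lia.
    have iA' : i.-1 < size A by lia.
    move=> h; have := invA i.-1; rewrite nth_rcons iA' => h'.
    by have := h' ltac:(lia) h; lia.
  + case=> [|i] /= iB h.
      have : x != r by apply: contraNneq rA => <-; rewrite mem_rcons inE eqxx.
      by move=> /eqP; rewrite /r; lia.
    have : nth 0 B i != r by apply: contraNneq rB => <-; exact: mem_nth.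
    move=> /eqP; rewrite /r => h'.
    by have := invB i iB; lia.
Qed.

(** The inverse of peeling.  After [to_right] the first number on the right is the
    one just peeled, [(size st.1).-1].  After [to_left] it is the former last
    element of the left region, which differs from [(size st.1).-1] since in a
    valid state a number smaller than [size st.1] on the left lies strictly right
    of its home. *)
Definition parent j st : state :=
  if head 0 st.2 == (size st.1).-1 then
    (take (size st.1).-1 st.1, last 0 st.1 :: behead st.2)
  else (rcons (rem (size st.1 + j) st.1) (head 0 st.2), behead st.2).

Lemma rem_insert p x s : x \notin s -> rem x (insert p x s) = s.
Proof.
by move=> xs; rewrite rem_mid ?cat_take_drop //; apply: contra xs => /mem_take.
Qed.

Lemma childrenK n j st st' :
  valid n j.+1 st -> st' \in children j st -> parent j st' = st.
Proof.
case: st => A B [[/= A0 B0] pW invA invB] st'in.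
have uW : uniq (word j.+1 (A, B)) by rewrite (perm_uniq pW) iota_uniq.
move: st'in; rewrite inE => /orP[/eqP->|/mapP[p]].
  case: B B0 {pW invB uW} => // y B _.
  by rewrite /parent /= size_rcons eqxx last_rcons -cats1 take_size_cat.
case/lastP: A A0 pW invA invB uW => // A x _ pW invA invB uW _ ->.
rewrite to_left_rcons /parent /= size_insert.
have := invA (size A); rewrite size_rcons nth_rcons ltnn eqxx => h.
case: eqP => [e|_]; first lia.
have rmid : (size A).+1 + j \in iota (size (rcons A x)) j.+1.
  by rewrite mem_iota size_rcons; lia.
have [/= rA _] := uniq_middle uW rmid.
by rewrite rem_insert //; apply: contra rA; rewrite mem_rcons inE orbC => ->.
Qed.

Lemma uniq_children n j st : valid n j.+1 st -> uniq (children j st).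
Proof.
case: st => A B [[/= A0 B0] pW invA invB].
have uW : uniq (word j.+1 (A, B)) by rewrite (perm_uniq pW) iota_uniq.
case/lastP: A A0 pW invA invB uW => // A x _ pW invA invB uW.
have rmid : (size A).+1 + j \in iota (size (rcons A x)) j.+1.
  by rewrite mem_iota size_rcons; lia.
have [/= rA _] := uniq_middle uW rmid.
have {}rA : (size A).+1 + j \notin A.
  by apply: contra rA; rewrite mem_rcons inE orbC => ->.
rewrite /children; apply/andP; split.
  apply/mapP => -[p _]; rewrite to_left_rcons => -[/(congr1 size) + _ _].
  by rewrite size_insert !size_rcons => /eqP; rewrite eqn_leq ltnn.
rewrite map_inj_in_uniq ?iota_uniq // => p q.
rewrite !mem_iota /= size_rcons => ps qs; rewrite !to_left_rcons => -[e].
have ix t : t <= size A -> index ((size A).+1 + j) (insert t ((size A).+1 + j) A) = t.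
  move=> tA; rewrite /insert index_cat /= eqxx addn0 size_takel //.
  by case: ifP => // /mem_take; rewrite (negbTE rA).
by rewrite -(ix p) // e ix.
Qed.

Lemma uniq_flatten_map (T U : eqType) (f : T -> seq U) (g : U -> T) (s : seq T) :
    uniq s -> {in s, forall x, uniq (f x)} ->
    {in s, forall x, {in f x, forall y, g y = x}} ->
  uniq (flatten [seq f x | x <- s]).
Proof.
elim: s => //= x s IHs /andP[xs us] uf gK.
rewrite cat_uniq uf ?mem_head // IHs //=; last first.
- by move=> y ys; apply: gK; rewrite inE ys orbT.
- by move=> y ys; apply: uf; rewrite inE ys orbT.
rewrite andbT; apply/hasPn => z /flattenP[_ /mapP[y ys ->] zy].
apply: contra xs => zx.
by rewrite -(gK x (mem_head _ _) z zx) (gK y _ z zy) // inE ys orbT.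
Qed.

Lemma descendantsP n j S :
    (forall st, st \in S -> valid n j st) -> uniq S ->
  uniq (descendants j S) /\ (forall st, st \in descendants j S -> valid n 0 st).
Proof.
elim: j S => [|j IHj] S invS uS; first by split.
apply: IHj => [st /flattenP[_ /mapP[st' /invS i' ->]]|].
  exact: valid_children.
apply: (uniq_flatten_map (g := parent j)) => //.
- by move=> st /invS; exact: uniq_children.
- by move=> st /invS i st' /(childrenK i).
Qed.

(** * Recovering the peeling from the final word *)

(** A number that lies in the region to which it was peeled is on that side of its
    home by position alone; for one that lies in the other region this is what
    validity asserts. *)
Lemma valid0_size n st x :
    valid n 0 st -> x < n ->
  (x < size st.1) = (x < index x (st.1 ++ st.2)).
Proof.
case: st => A B [_]; rewrite /word /= => pW invA invB xn.
have uW : uniq (A ++ B) by rewrite (perm_uniq pW) iota_uniq.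
have xAB : x \in A ++ B by rewrite (perm_mem pW) mem_iota.
move: xAB; rewrite index_cat mem_cat.
case: ifP => [xA _|xA /= xB].
  have iA : index x A < size A by rewrite index_mem.
  by have := invA _ iA; rewrite nth_index //; lia.
have iB : index x B < size B by rewrite index_mem.
by have := invB _ iB; rewrite nth_index //; lia.
Qed.

(** If one left region were longer, its word would show the number equal to the
    size of the shorter one right of home, and the other word would not. *)
Lemma word_inj n st st' :
  valid n 0 st -> valid n 0 st' -> word 0 st = word 0 st' -> st = st'.
Proof.
move=> i i'.
have sz (t : state) : valid n 0 t -> size t.1 < n.
  case=> [[_ B0] pW _ _]; have := perm_size pW.
  by rewrite /word /= size_cat size_iota; lia.
have le_sz (t t' : state) : valid n 0 t -> valid n 0 t' -> t.1 ++ t.2 = t'.1 ++ t'.2 ->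
    size t.1 <= size t'.1.
  move=> j j' e; have /esym h := valid0_size j' (sz _ j').
  by rewrite leqNgt (valid0_size j (sz _ j')) e h ltnn.
rewrite /word /= => e.
have es : size st.1 = size st'.1.
  by apply/eqP; rewrite eqn_leq (le_sz st) // (le_sz st').
case: st st' e es {i i' sz le_sz} => A B [A' B'] /= /eqP + es.
by rewrite eqseq_cat // => /andP[/eqP-> /eqP->].
Qed.

(** * Counting placements *)

(** One placement returns the peeled number to its end of the block and pushes the
    rest of the block off home; the other [2^j - 1] placements are the Towers of
    Hanoi. *)
Lemma sorts_child n j st st' :
    valid n j.+1 st -> st' \in children j st ->
  sorts (2 ^ j) (word j st') (word j.+1 st).
Proof.
case: st => A B [[/= A0 B0] pW invA invB].
have uW : uniq (word j.+1 (A, B)) by rewrite (perm_uniq pW) iota_uniq.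
have -> : 2 ^ j = 1 + (2 ^ j - 1) by have := expn_gt0 2 j; lia.
rewrite inE => /orP[/eqP->|/mapP[p]].
  case: B B0 {pW invB} uW => // y B _ uW.
  have uW' : uniq (word j (to_right (A, y :: B))).
    by rewrite (perm_uniq (perm_to_right _ _ _ _)).
  move: uW uW'; rewrite /word /to_right /= size_rcons cat_rcons => uW uW'.
  have uM : uniq (rcons A (size A) ++ y :: iota (size A).+1 j ++ B).
    rewrite -(perm_uniq (s1 := A ++ size A :: iota (size A).+1 j ++ y :: B)) //.
    by perm_by_count.
  have := @sorts_block_right j (rcons A (size A)) y B.
  rewrite size_rcons !cat_rcons in uM * => /(_ uM); apply: sorts_trans.
  rewrite -cat_rcons catA; apply: sorts_place => //.
  - by rewrite -catA cat_rcons.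
  - by rewrite -catA cat_rcons.
  - by rewrite size_cat size_rcons; lia.
case/lastP: A A0 pW invA invB uW => // A x _ pW invA invB uW.
rewrite mem_iota /= size_rcons => pA ->.
have : uniq (word j (to_left j (rcons A x, B) p)).
  by rewrite (perm_uniq (perm_to_left _ _ _ _ _)).
rewrite word_rcons to_left_rcons /word /= size_insert.
set r := (size A).+1 + j => uL.
have uM : uniq (A ++ iota (size A).+1 j ++ x :: r :: B).
  move: uW; rewrite word_rcons -/r.
  rewrite -(perm_uniq (s1 := A ++ x :: iota (size A).+1 j ++ r :: B)) //.
  by perm_by_count.
apply: sorts_trans (sorts_block_left uM).
move: uL; rewrite /insert -catA /= => uL.
rewrite -[x :: r :: B]/([:: x] ++ r :: B) !catA; apply: sorts_place.
- by rewrite !size_cat size_iota /= /r; lia.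
- by rewrite -!catA catA cat_take_drop.
- by rewrite -catA.
- by rewrite size_takel // /r; lia.
Qed.

Lemma sorts_descendant n j S st' :
    (forall st, st \in S -> valid n j st) -> st' \in descendants j S ->
  exists2 st, st \in S & sorts (2 ^ j - 1) (word 0 st') (word j st).
Proof.
elim: j S => [|j IHj] S invS /=; first by exists st'; last exact: sorts0.
case/IHj => [st /flattenP[_ /mapP[t /invS i ->]]|st]; first exact: valid_children.
case/flattenP => _ /mapP[t tS ->] st_t s1; exists t => //.
have -> : 2 ^ j.+1 - 1 = (2 ^ j - 1) + 2 ^ j.
  by rewrite expnS; have := expn_gt0 2 j; lia.
exact: sorts_trans s1 (sorts_child (invS _ tS) st_t).
Qed.

(** The only obstacles at the start are the largest number in the first position
    and [0] in the last. *)
Definition root m : state := ([:: m.+1], [:: 0]).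

Lemma perm_root m : perm_eq (word m (root m)) (iota 0 m.+2).
Proof.
rewrite (iotaS_rcons 0 m.+1) /word /= add0n.
by perm_by_count.
Qed.

Lemma valid_root m : valid m.+2 m (root m).
Proof.
split=> //; first exact: perm_root.
- by case=> //= _.
- by case=> //= _; lia.
Qed.

(** Placing the largest number pushes the block and [0] one step to the left, which
    is where the Towers of Hanoi start. *)
Lemma sorts_root m : sorts (2 ^ m) (word m (root m)) (iota 0 m.+2).
Proof.
have u : uniq (word m (root m)) by rewrite (perm_uniq (perm_root m)) iota_uniq.
have -> : 2 ^ m = 1 + (2 ^ m - 1) by have := expn_gt0 2 m; lia.
have -> : iota 0 m.+2 = [::] ++ 0 :: iota 1 m ++ [:: m.+1].
  by rewrite (iotaS_rcons 0 m.+1).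
have uM : uniq ([::] ++ iota 1 m ++ 0 :: [:: m.+1]).
  by rewrite -(perm_uniq (s1 := word m (root m))) // /word /=; perm_by_count.
apply: sorts_trans (sorts_block_left uM).
have -> : [::] ++ iota 1 m ++ [:: 0; m.+1] = (iota 1 m ++ [:: 0]) ++ [:: m.+1].
  by rewrite -catA.
apply: (@sorts_place m.+1 [::] (iota 1 m ++ [:: 0])) => //; last by rewrite cats0.
by rewrite size_cat size_iota addn1.
Qed.

(** * Words and permutations *)

Lemma map_rem (T U : eqType) (f : T -> U) x s : injective f ->
  map f (rem x s) = rem (f x) (map f s).
Proof.
move=> fI; elim: s => //= y s IHs; rewrite (inj_eq fI).
by case: ifP => //= _; rewrite IHs.
Qed.

Section OneLine.

Variable n : nat.
Implicit Types pi sigma : 'S_n.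

Definition one_line pi : seq nat := map val (codom pi).

Lemma size_one_line pi : size (one_line pi) = n.
Proof. by rewrite size_map size_codom card_ord. Qed.

Lemma nth_one_line pi (i : 'I_n) : nth 0 (one_line pi) i = pi i.
Proof.
rewrite (nth_map i) ?size_codom ?card_ord // /codom /image_mem.
by rewrite (nth_map i) ?size_enum_ord // nth_ord_enum.
Qed.

Lemma one_line_inj : injective one_line.
Proof.
by move=> pi sigma e; apply/permP=> i; apply: val_inj; rewrite /= -!nth_one_line e.
Qed.

Lemma one_line1 : one_line 1 = iota 0 n.
Proof.
apply: (@eq_from_nth _ 0); rewrite size_one_line ?size_iota // => i lt_in.
by rewrite -[i]/(val (Ordinal lt_in)) nth_one_line perm1 nth_iota.
Qed.

Lemma perm_one_line pi : perm_eq (one_line pi) (iota 0 n).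
Proof.
have inj_pi (sigma : 'S_n) : uniq (codom sigma).
  by apply/injectiveP; exact: perm_inj.
rewrite -one_line1; apply: perm_map; apply: uniq_perm => // i.
by rewrite -(permKV pi i) codom_f -[X in X \in codom _](permKV 1%g) codom_f.
Qed.

Lemma one_line_surj s : perm_eq s (iota 0 n) -> exists pi, one_line pi = s.
Proof.
move=> ps; have ss : size s = n by rewrite (perm_size ps) size_iota.
have us : uniq s by rewrite (perm_uniq ps) iota_uniq.
have lts (i : 'I_n) : nth 0 s i < n.
  have : nth 0 s i \in s by rewrite mem_nth ?ss.
  by rewrite (perm_mem ps) mem_iota.
have fI : injective (fun i : 'I_n => Ordinal (lts i)).
  move=> i j /(congr1 val)/eqP; rewrite /= nth_uniq ?ss // => /eqP.
  exact: val_inj.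
exists (perm fI); apply: (@eq_from_nth _ 0); rewrite size_one_line // => i lt_in.
by rewrite -[i]/(val (Ordinal lt_in)) nth_one_line permE.
Qed.

Lemma placement_one_line pi t :
  place_rel (one_line pi) t -> exists2 sigma, one_line sigma = t & placement pi sigma.
Proof.
case/hasP => i; rewrite mem_iota add0n size_one_line /= => lt_in /andP[ni /eqP et].
have it : i \in one_line pi by rewrite (perm_mem (perm_one_line pi)) mem_iota.
have [|sigma es] := @one_line_surj t.
  by rewrite et (perm_trans (perm_place it)) // perm_one_line.
exists sigma => //; apply/existsP; exists (Ordinal lt_in); apply/andP; split.
  by move: ni; rewrite -[i in nth 0 _ i]/(val (Ordinal lt_in)) nth_one_line.
apply/eqP/(inj_map val_inj); rewrite -/(one_line sigma) es et /place_seq.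
by rewrite map_cat /= map_take map_drop map_rem //; exact: val_inj.
Qed.

Lemma sorts_in_one_line k pi : sorts k (one_line pi) (iota 0 n) -> sorts_in k pi.
Proof.
case=> p szp [pp lp].
suff [q szq /andP[pq lq]] : exists2 q : seq 'S_n,
    size q = k & path (@placement n) pi q && (last pi q == 1%g).
  have szq' : size q == k by apply/eqP.
  by apply/existsP; exists (Tuple szq'); rewrite pq lq.
elim: p k pi szp pp lp => [|t p IHp] k pi /= szp.
  by move=> _ e; exists [::] => //=; apply/eqP/one_line_inj; rewrite one_line1.
case/andP=> /placement_one_line[sigma <- ps] pp lp.
case: k szp => // k [szp]; have [q szq /andP[pq lq]] := IHp k sigma szp pp lp.
by exists (sigma :: q); rewrite /= ?szq // ps pq.
Qed.

End OneLine.

Lemma leq_card_M m : rgf_count m 1 <= #|M m.+2|.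
Proof.
have inv_S st : st \in [:: root m] -> valid m.+2 m st.
  by rewrite inE => /eqP->; exact: valid_root.
have [uD invD] := descendantsP inv_S isT.
have -> : rgf_count m 1 = size [seq word 0 st | st <- descendants m [:: root m]].
  rewrite size_map size_descendants ?big_seq1 // => st.
  by rewrite inE => /eqP->.
rewrite cardE -(size_map (@one_line m.+2)); apply: uniq_leq_size.
  by rewrite map_inj_in_uniq // => st st' /invD i /invD i'; exact: word_inj i i'.
move=> _ /mapP[st st_in ->].
have [_ pW _ _] := invD _ st_in.
have [pi pis] := one_line_surj pW; rewrite -pis map_f // mem_enum inE.
apply: sorts_in_one_line; rewrite pis.
have [t] := sorts_descendant inv_S st_in; rewrite inE => /eqP-> s1.
have -> : (2 ^ (m.+2 - 1)) - 1 = (2 ^ m - 1) + 2 ^ m.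
  by rewrite subn1 expnS; have := expn_gt0 2 m; lia.
exact: sorts_trans s1 (sorts_root m).
Qed.

Theorem theorem6p6 (n : nat) (hn : 1 <= n) : bell (n - 1) <= #|M n|.
Proof.
apply: leq_trans (leq_bell _) _.
case: n hn => [|[|m]] // _; last by rewrite subn1 /= mul0n add0n leq_card_M.
apply/card_gt0P; exists 1%g; rewrite inE; apply: sorts_in_one_line.
by rewrite one_line1; exact: sorts0.
Qed.
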